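(* Let $p,q$ be positive integers, let $\Omega\subseteq\mathbb{C}$ be open and let $f:\Omega\to\mathbb{C}$ be sufficiently differentiable (of class $C^{q}$ in the real sense). Then: a) on $\Omega$, $$\left(-\partial_z+\overline{z}\right)^{q}(f)=q!\sum_{k=0}^{q}\frac{(-1)^k}{k!}\,\frac{\overline{z}^{\,q-k}}{(q-k)!}\,\partial_z^{k}(f);$$ b) on $\Omega\setminus\{0\}$, $$\left(-\partial_z+\overline{z}\right)^{q}(f)=q!\sum_{k=0}^{q}\frac{(-1)^k}{k!}\,\frac{H_{p,q-k}(z,\overline{z})}{(q-k)!}\,\partial_z^{k}\left(z^{-p}f\right).$$
   Context: For $z=x+iy\in\mathbb{C}$, $\partial_z=\frac12\left(\frac{\partial}{\partial x}-i\frac{\partial}{\partial y}\right)$ and $\partial_{\overline{z}}=\frac12\left(\frac{\partial}{\partial x}+i\frac{\partial}{\partial y}\right)$. The complex Hermite polynomials are, for integers $p,q\ge 0$, $$H_{p,q}(z,\overline{z})=(-1)^{p+q}e^{z\overline{z}}\,\partial_{\overline{z}}^{p}\partial_z^{q}\left(e^{-z\overline{z}}\right).$$ The operator $-\partial_z+\overline{z}$ sends $g$ to $-\partial_z g+\overline{z}g$, and its $q$-th power is the $q$-fold composition. *)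

(* Defs.v *)
From Stdlib Require Export Reals Factorial.
From Coquelicot Require Export Coquelicot.

Open Scope C_scope.

(* Functions on an open set Omega of the plane are total functions C -> C;
   their values outside Omega are irrelevant, since every notion below, at a
   point of an open set, depends only on the values near that point. *)

Definition ex_derive_x (f : C -> C) (z : C) : Prop :=
  ex_derive (fun t : R => Re (f (t, Im z))) (Re z) /\
  ex_derive (fun t : R => Im (f (t, Im z))) (Re z).

Definition ex_derive_y (f : C -> C) (z : C) : Prop :=
  ex_derive (fun t : R => Re (f (Re z, t))) (Im z) /\
  ex_derive (fun t : R => Im (f (Re z, t))) (Im z).

(* [Derive] is total: these are the partial derivatives only where
   [ex_derive_x] and [ex_derive_y] hold. *)
Definition partial_x (f : C -> C) (z : C) : C :=
  (Derive (fun t : R => Re (f (t, Im z))) (Re z),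
   Derive (fun t : R => Im (f (t, Im z))) (Re z)).

Definition partial_y (f : C -> C) (z : C) : C :=
  (Derive (fun t : R => Re (f (Re z, t))) (Im z),
   Derive (fun t : R => Im (f (Re z, t))) (Im z)).

(* Real differentiability class C^n on Omega: all partial derivatives in x and
   y (in any order) up to total order n exist and are continuous on Omega. *)
Fixpoint class_C (n : nat) (Omega : C -> Prop) (f : C -> C) : Prop :=
  (forall z : C, Omega z -> continuous f z) /\
  match n with
  | O => True
  | S m =>
      (forall z : C, Omega z -> ex_derive_x f z /\ ex_derive_y f z) /\
      class_C m Omega (partial_x f) /\ class_C m Omega (partial_y f)
  end.

Definition dz (f : C -> C) (z : C) : C :=
  / 2 * (partial_x f z - Ci * partial_y f z).

Definition dzbar (f : C -> C) (z : C) : C :=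
  / 2 * (partial_x f z + Ci * partial_y f z).

Definition Cexp (z : C) : C := RtoC (exp (Re z)) * (cos (Im z), sin (Im z)).

(* The value H_{p,q}(z, conj z), as a function of the point z. *)
Definition Hermite (p q : nat) (z : C) : C :=
  (-1) ^ (p + q) * Cexp (z * Cconj z) *
  Nat.iter p dzbar (Nat.iter q dz (fun w : C => Cexp (- (w * Cconj w)))) z.

Definition creation (g : C -> C) (z : C) : C := - dz g z + Cconj z * g z.

(* Main.v *)
(** Writing A for the creation operator, A (h g) = (A h) g - h (dz g), so that
    whenever A h_j = h_{j+1} for all j, the powers of A obey the Leibniz rule
    A^n (h_0 g) = sum_k C(n,k) h_{n-k} (- dz)^k g.  The polynomials H_{p,j}
    satisfy this with H_{p,0} = z^p and H_{0,j} = conj(z)^j; part a) is p = 0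
    with g = f, part b) is g = z^{-p} f. *)

From Stdlib Require Import Lia Lra.
Require Import Defs.

(** * Wirtinger derivatives at a point *)

(** Componentwise, to match [ex_derive_x] and [partial_x] and to let the calculus of real
    derivatives apply to each coordinate. As a relation it carries existence together with the
    value, unlike the total [Derive]. *)
Definition is_curve_derive (phi : R -> C) (t : R) (l : C) : Prop :=
  is_derive (fun s => Re (phi s)) t (Re l) /\
  is_derive (fun s => Im (phi s)) t (Im l).

Lemma is_curve_derive_const (c : C) (t : R) :
  is_curve_derive (fun _ => c) t 0.
Proof. split; apply @is_derive_const. Qed.

Lemma is_curve_derive_plus (f g : R -> C) (t : R) (l m : C) :
  is_curve_derive f t l -> is_curve_derive g t m ->
  is_curve_derive (fun s => f s + g s) t (l + m).
Proof.
  intros [fr fi] [gr gi]; split.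
  - exact (is_derive_plus _ _ _ _ _ fr gr).
  - exact (is_derive_plus _ _ _ _ _ fi gi).
Qed.

Lemma is_curve_derive_mult (f g : R -> C) (t : R) (l m : C) :
  is_curve_derive f t l -> is_curve_derive g t m ->
  is_curve_derive (fun s => f s * g s) t (l * g t + f t * m).
Proof.
  intros [fr fi] [gr gi]; split; simpl.
  - replace (_ + _)%R with
      ((Re l * Re (g t) + Re (f t) * Re m)
       - (Im l * Im (g t) + Im (f t) * Im m))%R
      by (unfold Re, Im; ring).
    apply @is_derive_minus; apply Derive.is_derive_mult; assumption.
  - replace (_ + _)%R with
      ((Re l * Im (g t) + Re (f t) * Im m)
       + (Im l * Re (g t) + Im (f t) * Re m))%R
      by (unfold Re, Im; ring).
    apply @is_derive_plus; apply Derive.is_derive_mult; assumption.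
Qed.

Lemma Cnorm2_neq_0 (z : C) : z <> 0 -> (Re z ^ 2 + Im z ^ 2 <> 0)%R.
Proof.
  intros Hz H; apply Hz.
  destruct z as [x y]; unfold Re, Im in H; simpl in H.
  apply injective_projections; simpl; nra.
Qed.

(** Since [1/f] is the conjugate of [f] divided by [|f|^2], each component follows from the real
    quotient rule. *)
Lemma is_curve_derive_inv (f : R -> C) (t : R) (l : C) :
  f t <> 0 -> is_curve_derive f t l ->
  is_curve_derive (fun s => / f s) t (- l / (f t * f t)).
Proof.
  intros Hf [fr fi].
  assert (Hn := Cnorm2_neq_0 _ Hf).
  assert (Hd : is_derive (fun s => Re (f s) ^ 2 + Im (f s) ^ 2)%R t
            (2 * Re l * Re (f t) + 2 * Im l * Im (f t))%R).
  { apply (is_derive_plus (fun s => Re (f s) ^ 2)%R).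
    - replace (2 * Re l * Re (f t))%R
        with (INR 2 * Re l * Re (f t) ^ Init.Nat.pred 2)%R by (simpl; ring).
      now apply is_derive_pow.
    - replace (2 * Im l * Im (f t))%R
        with (INR 2 * Im l * Im (f t) ^ Init.Nat.pred 2)%R by (simpl; ring).
      now apply is_derive_pow. }
  (* The claimed value divides by [f t * f t], whose squared modulus is the denominator [field]
     meets on that side; it is the square of the one in [Hn]. *)
  assert (Hq : (Re (f t * f t) ^ 2 + Im (f t * f t) ^ 2 <> 0)%R).
  { replace (_ + _)%R with ((Re (f t) ^ 2 + Im (f t) ^ 2) ^ 2)%R
      by (unfold Re, Im; simpl; ring).
    now apply pow_nonzero. }
  split.
  - apply (is_derive_ext
      (fun s => Re (f s) / (Re (f s) ^ 2 + Im (f s) ^ 2))%R); [reflexivity |].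
    eapply eq_rect; [apply (is_derive_div _ _ _ _ _ fr Hd Hn) |].
    unfold Re, Im in *; simpl in *; rewrite ?Rmult_1_r in Hn, Hq;
      field; split; assumption.
  - apply (is_derive_ext
      (fun s => (- Im (f s)) / (Re (f s) ^ 2 + Im (f s) ^ 2))%R);
      [reflexivity |].
    eapply eq_rect;
      [apply (is_derive_div _ _ _ _ _ (is_derive_opp _ _ _ fi) Hd Hn) |].
    unfold opp; simpl.
    unfold Re, Im in *; simpl in *; rewrite ?Rmult_1_r in Hn, Hq;
      field; split; assumption.
Qed.

(* [a] and [b] are the values of dz f and dzbar f at [z]; the derivatives along
   the axes are then a + b and i (a - b). *)
Definition is_wirtinger (f : C -> C) (z a b : C) : Prop :=
  is_curve_derive (fun t => f (t, Im z)) (Re z) (a + b) /\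
  is_curve_derive (fun t => f (Re z, t)) (Im z) (Ci * (a - b)).

Lemma eta_C (z : C) : (Re z, Im z) = z.
Proof. now destruct z. Qed.

Lemma is_wirtinger_eq (f : C -> C) (z a b a' b' : C) :
  is_wirtinger f z a b -> a = a' -> b = b' -> is_wirtinger f z a' b'.
Proof. now intros H <- <-. Qed.

Lemma is_wirtinger_const (c z : C) : is_wirtinger (fun _ => c) z 0 0.
Proof.
  split.
  - replace (0 + 0) with (RtoC 0) by ring; apply is_curve_derive_const.
  - replace (Ci * (0 - 0)) with (RtoC 0) by ring; apply is_curve_derive_const.
Qed.

Lemma is_wirtinger_id (z : C) : is_wirtinger (fun w => w) z 1 0.
Proof.
  split; split; simpl;
    match goal with |- is_derive _ _ ?l => ring_simplify l end;
    first [apply @is_derive_id | apply @is_derive_const].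
Qed.

Lemma is_wirtinger_conj (z : C) : is_wirtinger Cconj z 0 1.
Proof.
  split; split; simpl;
    match goal with |- is_derive _ _ ?l => ring_simplify l end;
    first [apply @is_derive_id | apply @is_derive_const |
           apply @is_derive_opp, @is_derive_id |
           apply (@is_derive_const R_AbsRing R_NormedModule (- Im z)%R)].
Qed.

Lemma is_wirtinger_plus (f g : C -> C) (z a b c d : C) :
  is_wirtinger f z a b -> is_wirtinger g z c d ->
  is_wirtinger (fun w => f w + g w) z (a + c) (b + d).
Proof.
  intros [fx fy] [gx gy]; split.
  - replace (a + c + (b + d)) with ((a + b) + (c + d)) by ring.
    now apply (is_curve_derive_plus (fun t => f (t, Im z))).
  - replace (Ci * _) with (Ci * (a - b) + Ci * (c - d)) by ring.
    now apply (is_curve_derive_plus (fun t => f (Re z, t))).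
Qed.

Lemma is_wirtinger_mult (f g : C -> C) (z a b c d : C) :
  is_wirtinger f z a b -> is_wirtinger g z c d ->
  is_wirtinger (fun w => f w * g w) z (a * g z + f z * c) (b * g z + f z * d).
Proof.
  intros [fx fy] [gx gy]; split.
  - replace (_ + _) with ((a + b) * g (Re z, Im z) + f (Re z, Im z) * (c + d))
      by (rewrite eta_C; ring).
    now apply (is_curve_derive_mult (fun t => f (t, Im z))
                 (fun t => g (t, Im z))).
  - replace (Ci * _) with
      (Ci * (a - b) * g (Re z, Im z) + f (Re z, Im z) * (Ci * (c - d)))
      by (rewrite eta_C; ring).
    now apply (is_curve_derive_mult (fun t => f (Re z, t))
                 (fun t => g (Re z, t))).
Qed.

Lemma is_wirtinger_inv (f : C -> C) (z a b : C) :
  f z <> 0 -> is_wirtinger f z a b ->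
  is_wirtinger (fun w => / f w) z (- a / (f z * f z)) (- b / (f z * f z)).
Proof.
  intros Hf [fx fy]; split.
  - replace (_ + _) with (- (a + b) / (f (Re z, Im z) * f (Re z, Im z)))
      by (rewrite eta_C; field; assumption).
    apply (is_curve_derive_inv (fun t => f (t, Im z)));
      [now rewrite eta_C | assumption].
  - replace (Ci * _) with
      (- (Ci * (a - b)) / (f (Re z, Im z) * f (Re z, Im z)))
      by (rewrite eta_C; field; assumption).
    apply (is_curve_derive_inv (fun t => f (Re z, t)));
      [now rewrite eta_C | assumption].
Qed.

Lemma is_wirtinger_pow (f : C -> C) (n : nat) (z a b : C) :
  is_wirtinger f z a b ->
  is_wirtinger (fun w => f w ^ n) z
    (INR n * f z ^ pred n * a) (INR n * f z ^ pred n * b).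
Proof.
  intros Hf; induction n as [|n IH].
  - eapply is_wirtinger_eq; [apply (is_wirtinger_const 1) | |]; simpl; ring.
  (* The factor [INR n] makes this hold at [n = 0] too, where [pred n] is 0 and both sides
     vanish. *)
  - assert (E : RtoC (INR n) * f z ^ n = f z * (RtoC (INR n) * f z ^ pred n))
      by (destruct n; simpl pred; [simpl | rewrite Cpow_S]; ring).
    eapply is_wirtinger_eq;
      [apply (is_wirtinger_mult f (fun w => f w ^ n) z _ _ _ _ Hf IH) | |];
      rewrite S_INR, RtoC_plus; simpl pred;
      [replace ((INR n + 1) * f z ^ n * a)
         with (INR n * f z ^ n * a + f z ^ n * a) by ring
      |replace ((INR n + 1) * f z ^ n * b)
         with (INR n * f z ^ n * b + f z ^ n * b) by ring]; rewrite E; ring.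
Qed.

Lemma is_wirtinger_partial (f : C -> C) (z a b : C) :
  is_wirtinger f z a b ->
  (ex_derive_x f z /\ ex_derive_y f z) /\
  partial_x f z = a + b /\ partial_y f z = Ci * (a - b).
Proof.
  intros [[xr xi] [yr yi]].
  split; [split; split; eexists; eassumption |].
  split; apply injective_projections; apply is_derive_unique; assumption.
Qed.

Lemma Ci_sqr : Ci * Ci = -1.
Proof. apply injective_projections; simpl; ring. Qed.

Lemma half_sum (a b : C) : / 2 * (a + b + (a - b)) = a.
Proof. field. Qed.

Lemma is_wirtinger_unique (f : C -> C) (z a b : C) :
  is_wirtinger f z a b -> dz f z = a /\ dzbar f z = b.
Proof.
  intros H; destruct (is_wirtinger_partial _ _ _ _ H) as [_ [Hx Hy]].
  unfold dz, dzbar; rewrite Hx, Hy.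
  replace (Ci * (Ci * (a - b))) with (Ci * Ci * (a - b)) by ring.
  rewrite Ci_sqr; split.
  - rewrite <- (half_sum a b) at 3; ring.
  - rewrite <- (half_sum b a) at 3; ring.
Qed.

(** Solving the definitions of [dz] and [dzbar] for the partial derivatives gives [dz + dzbar] along
    x and [i (dz - dzbar)] along y. This is how the hypotheses in [class_C] enter the relational
    calculus. *)
Lemma ex_derive_is_wirtinger (f : C -> C) (z : C) :
  ex_derive_x f z -> ex_derive_y f z ->
  is_wirtinger f z (dz f z) (dzbar f z).
Proof.
  intros [xr xi] [yr yi]; unfold dz, dzbar.
  set (X := partial_x f z); set (Y := partial_y f z).
  split.
  - replace (_ + _) with X.
    + split; apply Derive_correct; assumption.
    + rewrite <- (half_sum X (Ci * Y)) at 1; ring.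
  - replace (Ci * _) with Y.
    + split; apply Derive_correct; assumption.
    + replace (Ci * (/ 2 * (X - Ci * Y) - / 2 * (X + Ci * Y)))
        with (- (Ci * Ci) * (/ 2 * (Y + Y + (Y - Y)))) by ring.
      rewrite half_sum, Ci_sqr.
      apply injective_projections; simpl; ring.
Qed.

(** * Locality of the derivatives on open sets *)

Lemma open_locally_x (Omega : C -> Prop) (z : C) :
  open Omega -> Omega z -> locally (Re z) (fun t => Omega (t, Im z)).
Proof.
  intros HO Hz; destruct (HO z Hz) as [e He].
  exists e; intros t Ht; apply He; split; [exact Ht | apply ball_center].
Qed.

Lemma open_locally_y (Omega : C -> Prop) (z : C) :
  open Omega -> Omega z -> locally (Im z) (fun t => Omega (Re z, t)).
Proof.
  intros HO Hz; destruct (HO z Hz) as [e He].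
  exists e; intros t Ht; apply He; split; [apply ball_center | exact Ht].
Qed.

(** Both derivatives are taken along axis-parallel segments through [z], short pieces of which stay
    in [Omega]. With [Omega] the whole plane, this replaces a function by a pointwise equal one
    without functional extensionality. *)
Lemma is_wirtinger_ext (Omega : C -> Prop) (f g : C -> C) (z a b : C) :
  open Omega -> Omega z -> (forall w, Omega w -> f w = g w) ->
  is_wirtinger f z a b -> is_wirtinger g z a b.
Proof.
  intros HO Hz Hfg [[xr xi] [yr yi]].
  split; split; eapply is_derive_ext_loc; try eassumption.
  1, 2: apply (filter_imp (fun t => Omega (t, Im z)));
    [intros t Ht; now rewrite Hfg | now apply open_locally_x].
  all: apply (filter_imp (fun t => Omega (Re z, t)));
    [intros t Ht; now rewrite Hfg | now apply open_locally_y].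
Qed.

Lemma partial_ext (Omega : C -> Prop) (f g : C -> C) (z : C) :
  open Omega -> Omega z -> (forall w, Omega w -> f w = g w) ->
  partial_x f z = partial_x g z /\ partial_y f z = partial_y g z.
Proof.
  intros HO Hz Hfg; unfold partial_x, partial_y; split;
    apply injective_projections; simpl; apply Derive_ext_loc.
  1, 2: apply (filter_imp (fun t => Omega (t, Im z)));
    [intros t Ht; now rewrite Hfg | now apply open_locally_x].
  all: apply (filter_imp (fun t => Omega (Re z, t)));
    [intros t Ht; now rewrite Hfg | now apply open_locally_y].
Qed.

Lemma dz_ext (Omega : C -> Prop) (f g : C -> C) (z : C) :
  open Omega -> Omega z -> (forall w, Omega w -> f w = g w) ->
  dz f z = dz g z.
Proof.
  intros HO Hz Hfg; unfold dz.
  now destruct (partial_ext Omega f g z HO Hz Hfg) as [-> ->].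
Qed.

(** * The classes C^n *)

Lemma continuous_C (f : C -> C) (z : C) :
  continuous f z <->
  continuous (fun w => Re (f w)) z /\ continuous (fun w => Im (f w)) z.
Proof.
  split.
  - intros H; split.
    + apply (continuous_comp f fst); [exact H |].
      destruct (f z); apply continuous_fst.
    + apply (continuous_comp f snd); [exact H |].
      destruct (f z); apply continuous_snd.
  - intros [Hr Hi].
    apply (continuous_ext (fun w => (Re (f w), Im (f w))));
      [intros w; apply eta_C |].
    apply (continuous_comp_2 (fun w => Re (f w)) (fun w => Im (f w)) pair);
      [exact Hr | exact Hi |].
    apply (continuous_ext (fun x => x)); [now intros [] |].
    apply continuous_id.
Qed.

Lemma continuous_Cplus (f g : C -> C) (z : C) :
  continuous f z -> continuous g z -> continuous (fun w => f w + g w) z.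
Proof.
  rewrite !continuous_C; intros [fr fi] [gr gi]; split.
  - exact (continuous_plus (fun w => Re (f w)) (fun w => Re (g w)) z fr gr).
  - exact (continuous_plus (fun w => Im (f w)) (fun w => Im (g w)) z fi gi).
Qed.

Lemma continuous_Rmult {U : UniformSpace} (f g : U -> R) (z : U) :
  continuous f z -> continuous g z -> continuous (fun w => (f w * g w)%R) z.
Proof. exact (continuous_mult (K := R_AbsRing) f g z). Qed.

Lemma continuous_Cmult (f g : C -> C) (z : C) :
  continuous f z -> continuous g z -> continuous (fun w => f w * g w) z.
Proof.
  rewrite !continuous_C; intros [fr fi] [gr gi]; split.
  - apply (continuous_minus (fun w => Re (f w) * Re (g w))%R
             (fun w => Im (f w) * Im (g w))%R);
      now apply continuous_Rmult.
  - apply (continuous_plus (fun w => Re (f w) * Im (g w))%R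
             (fun w => Im (f w) * Re (g w))%R);
      now apply continuous_Rmult.
Qed.

(** The inverse of [w] is its conjugate divided by [|w|^2], and the real inverse is continuous away
    from 0. *)
Lemma continuous_Cinv (z : C) : z <> 0 -> continuous Cinv z.
Proof.
  intros Hz; assert (Hn := Cnorm2_neq_0 _ Hz).
  assert (Hc : continuous (fun w : C => / (Re w ^ 2 + Im w ^ 2))%R z).
  { apply (continuous_comp (fun w : C => (Re w ^ 2 + Im w ^ 2)%R) Rinv);
      [| now apply continuous_Rinv].
    apply (continuous_ext (fun w : C => (Re w * Re w + Im w * Im w)%R));
      [intros; simpl; ring |].
    destruct z as [x y].
    apply (continuous_plus (fun w : C => (Re w * Re w)%R)
             (fun w : C => (Im w * Im w)%R));
      apply continuous_Rmult; first [apply continuous_fst | apply continuous_snd]. }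
  destruct z as [x y].
  apply continuous_C; split; apply continuous_Rmult; try exact Hc.
  - apply continuous_fst.
  - apply (continuous_opp (fun w : C => Im w)), continuous_snd.
Qed.

Lemma class_C_continuous (n : nat) (Omega : C -> Prop) (f : C -> C) (z : C) :
  class_C n Omega f -> Omega z -> continuous f z.
Proof. destruct n; intros [H _]; apply H. Qed.

Lemma class_C_is_wirtinger (n : nat) (Omega : C -> Prop) (f : C -> C) (z : C) :
  class_C (S n) Omega f -> Omega z -> is_wirtinger f z (dz f z) (dzbar f z).
Proof.
  intros [_ [H _]] Hz; destruct (H z Hz); now apply ex_derive_is_wirtinger.
Qed.

Lemma class_C_S (n : nat) (Omega : C -> Prop) (f : C -> C) :
  class_C (S n) Omega f -> class_C n Omega f.
Proof.
  revert f; induction n as [|n IH]; intros f [Hc [Hd [Hx Hy]]].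
  - now split.
  - split; [exact Hc |]; split; [exact Hd |]; split; now apply IH.
Qed.

(** Openness passes equality on [Omega] from the functions to their partial derivatives, so the
    induction runs over all pairs [f], [g]. *)
Lemma class_C_ext (n : nat) (Omega : C -> Prop) (f g : C -> C) :
  open Omega -> (forall w, Omega w -> f w = g w) ->
  class_C n Omega f -> class_C n Omega g.
Proof.
  intros HO; revert f g; induction n as [|n IH]; intros f g Hfg Hf.
  all: assert (Hc : forall z, Omega z -> continuous g z)
    by (intros z Hz; apply (continuous_ext_loc g f z);
        [apply (filter_imp Omega); [exact Hfg | exact (HO z Hz)]
        | exact (class_C_continuous _ _ _ _ Hf Hz)]).
  - now split.
  - split; [exact Hc |]; split; [| split].
    + intros z Hz; eapply is_wirtinger_partial.
      apply (is_wirtinger_ext Omega f); try assumption.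
      now apply (class_C_is_wirtinger n Omega).
    + apply (IH (partial_x f)); [| apply Hf].
      intros w Hw; now apply (partial_ext Omega).
    + apply (IH (partial_y f)); [| apply Hf].
      intros w Hw; now apply (partial_ext Omega).
Qed.

Lemma class_C_subset (n : nat) (A B : C -> Prop) (f : C -> C) :
  (forall z, A z -> B z) -> class_C n B f -> class_C n A f.
Proof.
  intros HAB; revert f; induction n as [|n IH]; intros f Hf.
  - split; [intros; now apply Hf, HAB | exact I].
  - destruct Hf as [Hc [Hd [Hx Hy]]].
    split; [intros; now apply Hc, HAB |]; split; [intros; now apply Hd, HAB |].
    split; now apply IH.
Qed.

Lemma continuous_scal_plus (u v : C) (f g : C -> C) (z : C) :
  continuous f z -> continuous g z ->
  continuous (fun w => u * f w + v * g w) z.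
Proof.
  intros Hf Hg.
  apply (continuous_Cplus (fun w => u * f w) (fun w => v * g w));
    apply (continuous_Cmult (fun _ => _)); try assumption;
    apply continuous_const.
Qed.

(** Constant-coefficient combinations are all that is needed to pass between the pair [partial_x],
    [partial_y] and the pair [dz], [dzbar]. Proving this case first makes that passage available for
    the product rule. *)
Lemma class_C_scal_plus (n : nat) (Omega : C -> Prop) (u v : C) (f g : C -> C) :
  open Omega -> class_C n Omega f -> class_C n Omega g ->
  class_C n Omega (fun w => u * f w + v * g w).
Proof.
  intros HO; revert f g; induction n as [|n IH]; intros f g Hf Hg.
  all: assert (Hc : forall z, Omega z ->
                 continuous (fun w => u * f w + v * g w) z)
    by (intros z Hz; apply continuous_scal_plus;
        eapply class_C_continuous; eassumption).
  - now split.
  - assert (Hw : forall z, Omega z ->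
      (ex_derive_x (fun w => u * f w + v * g w) z /\
       ex_derive_y (fun w => u * f w + v * g w) z) /\
      partial_x (fun w => u * f w + v * g w) z
        = u * partial_x f z + v * partial_x g z /\
      partial_y (fun w => u * f w + v * g w) z
        = u * partial_y f z + v * partial_y g z).
    { intros z Hz.
      assert (Wf := class_C_is_wirtinger _ _ _ _ Hf Hz).
      assert (Wg := class_C_is_wirtinger _ _ _ _ Hg Hz).
      assert (W := is_wirtinger_plus _ _ _ _ _ _ _
        (is_wirtinger_mult _ _ _ _ _ _ _ (is_wirtinger_const u z) Wf)
        (is_wirtinger_mult _ _ _ _ _ _ _ (is_wirtinger_const v z) Wg)).
      apply is_wirtinger_partial in W; destruct W as [We [Wx Wy]].
      apply is_wirtinger_partial in Wf; destruct Wf as [_ [fx fy]].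
      apply is_wirtinger_partial in Wg; destruct Wg as [_ [gx gy]].
      split; [exact We |].
      split; [rewrite fx, gx | rewrite fy, gy];
        [etransitivity; [exact Wx | ring] | etransitivity; [exact Wy | ring]]. }
    split; [exact Hc |]; split; [intros z Hz; now apply Hw | split].
    + apply (class_C_ext n Omega
               (fun z => u * partial_x f z + v * partial_x g z)); [exact HO | |].
      * intros z Hz; symmetry; now apply Hw.
      * apply IH; [apply Hf | apply Hg].
    + apply (class_C_ext n Omega
               (fun z => u * partial_y f z + v * partial_y g z)); [exact HO | |].
      * intros z Hz; symmetry; now apply Hw.
      * apply IH; [apply Hf | apply Hg].
Qed.

(** The partial derivatives are [a + b] and [i (a - b)], so regularity can be checked on the
    Wirtinger derivatives alone. *)
Lemma class_C_of_wirtinger (n : nat) (Omega : C -> Prop) (f a b : C -> C) :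
  open Omega -> (forall z, Omega z -> continuous f z) ->
  (forall z, Omega z -> is_wirtinger f z (a z) (b z)) ->
  class_C n Omega a -> class_C n Omega b -> class_C (S n) Omega f.
Proof.
  intros HO Hc Hw Ha Hb.
  split; [exact Hc |]; split; [| split].
  - intros z Hz; eapply is_wirtinger_partial; now apply Hw.
  - apply (class_C_ext n Omega (fun z => 1 * a z + 1 * b z)); [exact HO | |].
    + intros z Hz; destruct (is_wirtinger_partial _ _ _ _ (Hw z Hz))
        as [_ [-> _]]; ring.
    + now apply class_C_scal_plus.
  - apply (class_C_ext n Omega (fun z => Ci * a z + - Ci * b z)); [exact HO | |].
    + intros z Hz; destruct (is_wirtinger_partial _ _ _ _ (Hw z Hz))
        as [_ [_ ->]]; ring.
    + now apply class_C_scal_plus.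
Qed.

Lemma class_C_dz (n : nat) (Omega : C -> Prop) (f : C -> C) :
  open Omega -> class_C (S n) Omega f -> class_C n Omega (dz f).
Proof.
  intros HO [_ [_ [Hx Hy]]].
  apply (class_C_ext n Omega
    (fun z => / 2 * partial_x f z + (- Ci / 2) * partial_y f z)); [exact HO | |].
  - intros w _; unfold dz, Cdiv; ring.
  - now apply class_C_scal_plus.
Qed.

Lemma class_C_dzbar (n : nat) (Omega : C -> Prop) (f : C -> C) :
  open Omega -> class_C (S n) Omega f -> class_C n Omega (dzbar f).
Proof.
  intros HO [_ [_ [Hx Hy]]].
  apply (class_C_ext n Omega
    (fun z => / 2 * partial_x f z + (Ci / 2) * partial_y f z)); [exact HO | |].
  - intros w _; unfold dzbar, Cdiv; ring.
  - now apply class_C_scal_plus.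
Qed.

(** Each Wirtinger derivative of the product is a sum of two products of a factor and a derivative,
    all of class C^n once the undifferentiated factor is lowered by one order; the induction
    hypothesis then applies. *)
Lemma class_C_mult (n : nat) (Omega : C -> Prop) (f g : C -> C) :
  open Omega -> class_C n Omega f -> class_C n Omega g ->
  class_C n Omega (fun w => f w * g w).
Proof.
  intros HO; revert f g; induction n as [|n IH]; intros f g Hf Hg.
  all: assert (Hc : forall z, Omega z -> continuous (fun w => f w * g w) z)
    by (intros z Hz; apply continuous_Cmult;
        eapply class_C_continuous; eassumption).
  - now split.
  - apply (class_C_of_wirtinger n Omega _
      (fun z => dz f z * g z + f z * dz g z)
      (fun z => dzbar f z * g z + f z * dzbar g z)); try assumption.
    + intros z Hz; apply is_wirtinger_mult;
        now apply (class_C_is_wirtinger n Omega).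
    + apply (class_C_ext n Omega
        (fun z => 1 * (dz f z * g z) + 1 * (f z * dz g z)));
        [exact HO | intros; ring |].
      apply (class_C_scal_plus n Omega 1 1 (fun z => dz f z * g z)
               (fun z => f z * dz g z)); [exact HO | |];
        apply IH; first [now apply class_C_dz | now apply class_C_S].
    + apply (class_C_ext n Omega
        (fun z => 1 * (dzbar f z * g z) + 1 * (f z * dzbar g z)));
        [exact HO | intros; ring |].
      apply (class_C_scal_plus n Omega 1 1 (fun z => dzbar f z * g z)
               (fun z => f z * dzbar g z)); [exact HO | |];
        apply IH; first [now apply class_C_dzbar | now apply class_C_S].
Qed.

Lemma class_C_const (n : nat) (Omega : C -> Prop) (c : C) :
  open Omega -> class_C n Omega (fun _ => c).
Proof.
  intros HO; revert c; induction n as [|n IH]; intros c.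
  - split; [intros; apply continuous_const | exact I].
  - apply (class_C_of_wirtinger n Omega _ (fun _ => 0) (fun _ => 0));
      try assumption; try apply IH; intros.
    + apply continuous_const.
    + apply is_wirtinger_const.
Qed.

(** The [dz] derivative of the inverse is [- (1/z)(1/z)] and its [dzbar] derivative is 0: the
    derivatives are polynomial in the inverse itself, which closes the induction. *)
Lemma class_C_Cinv (n : nat) (Omega : C -> Prop) :
  open Omega -> (forall z, Omega z -> z <> 0) -> class_C n Omega Cinv.
Proof.
  intros HO H0.
  assert (Hc : forall z, Omega z -> continuous Cinv z)
    by (intros; now apply continuous_Cinv, H0).
  induction n as [|n IH]; [now split |].
  apply (class_C_of_wirtinger n Omega _ (fun z => -1 * (/ z * / z))
           (fun _ => 0)); try assumption.
  - intros z Hz; assert (z <> 0) by now apply H0.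
    eapply is_wirtinger_eq;
      [apply (is_wirtinger_inv (fun w => w)), is_wirtinger_id; assumption
      | field; assumption | field; assumption].
  - apply (class_C_mult n Omega (fun _ => -1)); [exact HO | |].
    + now apply class_C_const.
    + now apply (class_C_mult n Omega).
  - now apply class_C_const.
Qed.

Lemma class_C_pow (n p : nat) (Omega : C -> Prop) (f : C -> C) :
  open Omega -> class_C n Omega f -> class_C n Omega (fun w => f w ^ p).
Proof.
  intros HO Hf; induction p as [|p IH].
  - now apply (class_C_const n Omega 1).
  - now apply (class_C_mult n Omega f (fun w => f w ^ p)).
Qed.

Lemma class_C_iter_dz (k n : nat) (Omega : C -> Prop) (f : C -> C) :
  open Omega -> class_C (k + n) Omega f -> class_C n Omega (Nat.iter k dz f).
Proof.
  intros HO; revert n; induction k as [|k IH]; intros n Hf; [exact Hf |].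
  apply class_C_dz; [exact HO |]; apply IH.
  now replace (k + S n)%nat with (S k + n)%nat by lia.
Qed.

(** * The Leibniz rule for the creation operator *)

(** Allows [f] to be rewritten as [z^p (z^{-p} f)] under the powers of the operator, although that
    identity fails at the origin. *)
Lemma iter_creation_ext (n : nat) (Omega : C -> Prop) (f g : C -> C) :
  open Omega -> (forall w, Omega w -> f w = g w) ->
  forall z, Omega z -> Nat.iter n creation f z = Nat.iter n creation g z.
Proof.
  intros HO Hfg; induction n as [|n IH]; intros z Hz; [now apply Hfg |].
  change (creation (Nat.iter n creation f) z = creation (Nat.iter n creation g) z).
  unfold creation at 1 3.
  now rewrite (dz_ext Omega _ _ z HO Hz IH), (IH z Hz).
Qed.

(** * Finite complex sums and factorials *)

Lemma sum_n_S (u : nat -> C) (n : nat) : sum_n u (S n) = sum_n u n + u (S n).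
Proof. exact (sum_Sn (G := C_AbelianMonoid) u n). Qed.

Lemma sum_n_0 (u : nat -> C) : sum_n u 0 = u 0%nat.
Proof. exact (sum_O (G := C_AbelianMonoid) u). Qed.

Lemma is_wirtinger_sum_n (F : nat -> C -> C) (a b : nat -> C) (z : C) (n : nat) :
  (forall k, (k <= n)%nat -> is_wirtinger (F k) z (a k) (b k)) ->
  is_wirtinger (fun w => sum_n (fun k => F k w) n) z (sum_n a n) (sum_n b n).
Proof.
  induction n as [|n IH]; intros H.
  - rewrite !sum_n_0.
    apply (is_wirtinger_ext (fun _ => True) (F 0%nat));
      [apply open_true | exact I | intros; now rewrite sum_n_0 | now apply H].
  - rewrite !sum_n_S.
    apply (is_wirtinger_ext (fun _ => True)
             (fun w => sum_n (fun k => F k w) n + F (S n) w));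
      [apply open_true | exact I | intros; now rewrite sum_n_S |].
    apply is_wirtinger_plus; [apply IH; intros; apply H; lia | now apply H].
Qed.

Lemma sum_n_Cmult_l (c : C) (u : nat -> C) (n : nat) :
  sum_n (fun k => c * u k) n = c * sum_n u n.
Proof. exact (sum_n_mult_l (K := C_Ring) c u n). Qed.

Lemma sum_n_Cplus (u v : nat -> C) (n : nat) :
  sum_n (fun k => u k + v k) n = sum_n u n + sum_n v n.
Proof. exact (sum_n_plus (G := C_AbelianMonoid) u v n). Qed.

(** The terms [- k u_k] and [(k+1) u_{k+1}] telescope, leaving only the last one. For [c = n + 1]
    the result is [n + 1] times the sum up to [n + 1]; this takes the place of Pascal's rule in the
    Leibniz induction. *)
Lemma sum_n_pascal (c : C) (u : nat -> C) (n : nat) :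
  (sum_n (fun k => (c - INR k) * u k + INR (S k) * u (S k)) n : C)
  = c * sum_n u n + INR (S n) * u (S n).
Proof.
  induction n as [|n IH].
  - rewrite !sum_n_0; simpl; ring.
  - rewrite !sum_n_S, IH; ring.
Qed.

Lemma INR_fact_neq_0_C (n : nat) : RtoC (INR (fact n)) <> 0.
Proof. intros H; apply RtoC_inj in H; now apply (INR_fact_neq_0 n). Qed.

Lemma INR_fact_S (n : nat) :
  RtoC (INR (fact (S n))) = INR (S n) * INR (fact n).
Proof. now rewrite <- RtoC_mult, <- mult_INR. Qed.

Lemma INR_S_neq_0_C (n : nat) : RtoC (INR (S n)) <> 0.
Proof. intros H; apply RtoC_inj in H; now apply (not_0_INR (S n)). Qed.

(* The hypothesis on [h] says that creation (h j) = h (S j). *)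
Lemma iter_creation_mult (Omega : C -> Prop) (h b : nat -> C -> C)
  (g : C -> C) (n : nat) :
  open Omega ->
  (forall j z, is_wirtinger (h j) z (Cconj z * h j z - h (S j) z) (b j z)) ->
  class_C n Omega g ->
  forall z, Omega z ->
  Nat.iter n creation (fun w => h 0%nat w * g w) z =
  INR (fact n) *
  sum_n (fun k =>
    (-1) ^ k / INR (fact k) * (h (n - k)%nat z / INR (fact (n - k))) *
    Nat.iter k dz g z) n.
Proof.
  intros HO Hh; induction n as [|n IH]; intros Hg z Hz.
  - rewrite sum_n_0; simpl; field.
  - specialize (IH (class_C_S _ _ _ Hg)).
    change (Nat.iter (S n) creation ?x z)
      with (creation (Nat.iter n creation x) z).
    unfold creation at 1.
    (* The induction hypothesis holds on all of the open set [Omega], so it may be differentiated at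
       [z]. *)
    rewrite (dz_ext Omega _ _ z HO Hz IH), (IH z Hz).
    set (c := fun k : nat => (-1) ^ k / INR (fact k)).
    (* [u k] is the k-th summand of the formula at order [n + 1]. *)
    set (u := fun k : nat =>
      c k * (h (S n - k)%nat z / INR (fact (S n - k))) * Nat.iter k dz g z).
    set (D := fun k : nat => Nat.iter k dz g z).
    assert (W : dz (fun w => INR (fact n) * sum_n (fun k =>
         c k * (h (n - k)%nat w / INR (fact (n - k))) * Nat.iter k dz g w) n) z
       = INR (fact n) * sum_n (fun k => c k / INR (fact (n - k)) *
           ((Cconj z * h (n - k)%nat z - h (S (n - k)) z) * D k
            + h (n - k)%nat z * D (S k))) n).
    { eapply is_wirtinger_unique, is_wirtinger_eq;
        [apply is_wirtinger_mult;
         [apply is_wirtinger_const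
         | apply (is_wirtinger_sum_n (fun k w =>
             c k * (h (n - k)%nat w / INR (fact (n - k))) * Nat.iter k dz g w)
             (fun k => c k / INR (fact (n - k)) *
           ((Cconj z * h (n - k)%nat z - h (S (n - k)) z) * D k
            + h (n - k)%nat z * D (S k)))
           (fun k => c k / INR (fact (n - k)) *
             (b (n - k)%nat z * D k + h (n - k)%nat z * dzbar (Nat.iter k dz g) z)))]
        | cbv beta; ring | reflexivity].
      intros k Hk.
      apply (is_wirtinger_ext (fun _ => True) (fun w =>
        c k / INR (fact (n - k)) * (h (n - k)%nat w * Nat.iter k dz g w)));
        [apply open_true | exact I
        | intros; field; apply INR_fact_neq_0_C |].
      eapply is_wirtinger_eq;
        [apply is_wirtinger_mult; [apply is_wirtinger_const |];
         apply is_wirtinger_mult; [apply Hh |];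
         apply (class_C_is_wirtinger 0 Omega); [| exact Hz];
         apply class_C_iter_dz; [exact HO |]
        | unfold D; simpl; ring | unfold D; ring].
      (* Differentiating the k-th iterate once requires [g] of class C^{k+1}; this is reached from
         C^{n+1} by dropping [n - k] orders. *)
      clear - Hg Hk HO.
      replace (S n) with ((n - k) + (k + 1))%nat in Hg by lia.
      revert Hg; generalize (n - k)%nat as m; intros m.
      induction m as [|m IHm]; [easy | intros H; now apply IHm, class_C_S]. }
    etransitivity; [apply (f_equal (fun t => - t + _) W) |].
    (* In [- dz + conj z] the terms with [conj z] cancel. What remains of the k-th summand is
       [c_k / (n-k)!] times [h_{n+1-k} D_k - h_{n-k} D_{k+1}], that is
       [(n+1-k) u_k + (k+1) u_{k+1}], because [(k+1) c_{k+1} = - c_k]. *)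
    transitivity (INR (fact n) * sum_n (fun k =>
      (INR (S n) - INR k) * u k + INR (S k) * u (S k)) n).
    + replace (- (INR (fact n) * _) + _) with
        (INR (fact n) * sum_n (fun k =>
          -1 * (c k / INR (fact (n - k)) *
           ((Cconj z * h (n - k)%nat z - h (S (n - k)) z) * D k
            + h (n - k)%nat z * D (S k)))
          + Cconj z * (c k * (h (n - k)%nat z / INR (fact (n - k))) * D k)) n)
        by (rewrite sum_n_Cplus, !sum_n_Cmult_l; unfold c, D; ring).
      f_equal; apply sum_n_ext_loc; intros k Hk; unfold u, c.
      (* The equality is restated in [C] itself rather than in the carrier of the monoid structure,
         so that [field] recognises it. *)
      match goal with |- @eq _ ?x ?y => change (@eq C x y) end.
      fold (D k) (D (S k)).
      replace (S n - S k)%nat with (n - k)%nat by lia.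
      replace (S n - k)%nat with (S (n - k)) by lia.
      rewrite <- RtoC_minus, <- minus_INR by lia.
      replace (S n - k)%nat with (S (n - k)) by lia.
      rewrite !INR_fact_S, Cpow_S; unfold c.
      field; repeat split; first [apply INR_fact_neq_0_C | apply INR_S_neq_0_C].
    + change (INR (fact n) * sum_n (fun k =>
        (INR (S n) - INR k) * u k + INR (S k) * u (S k)) n
        = INR (fact (S n)) * sum_n u (S n)).
      rewrite sum_n_pascal, INR_fact_S, sum_n_S; ring.
Qed.

(** * Complex Hermite polynomials *)

(* [hermite_poly p q] is the polynomial H_{p,q}; at p = 0 the factor [INR p]
   cancels the junk index [pred p]. *)
Fixpoint hermite_poly (p q : nat) (z : C) : C :=
  match q with
  | O => z ^ p
  | S r => Cconj z * hermite_poly p r z - INR p * hermite_poly (pred p) r z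
  end.

Lemma hermite_poly_0_l (q : nat) (z : C) : hermite_poly 0 q z = Cconj z ^ q.
Proof.
  induction q as [|q IH]; [reflexivity |].
  simpl hermite_poly; rewrite IH; simpl; ring.
Qed.

(** The defining recursion raises [q]; this is its mirror image raising [p], which multiplying by
    the Gaussian and applying [dzbar] will produce. *)
Lemma hermite_poly_S_l (p q : nat) (z : C) :
  hermite_poly (S p) q z
  = z * hermite_poly p q z - INR q * hermite_poly p (pred q) z.
Proof.
  revert p; induction q as [|q IH]; intros p; [simpl; ring |].
  change (Cconj z * hermite_poly (S p) q z - INR (S p) * hermite_poly p q z
    = z * (Cconj z * hermite_poly p q z - INR p * hermite_poly (pred p) q z)
      - INR (S q) * hermite_poly p q z).
  rewrite IH.
  (* [E] is the defining recursion one step down and [E'] the induction hypothesis one step down in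
     [p]; the factors [INR q] and [INR p] cover the zero cases. They show that
     [q (conj z) H_{p,q-1} + p H_{p,q}] and [p z H_{p-1,q} + q H_{p,q}] agree, both being [q (conj
     z) H_{p,q-1} + p z H_{p-1,q} - p q H_{p-1,q-1}]. *)
  assert (E : INR q * hermite_poly p q z = INR q *
     (Cconj z * hermite_poly p (pred q) z
      - INR p * hermite_poly (pred p) (pred q) z))
    by (destruct q; [simpl; ring | reflexivity]).
  assert (E' : INR p * hermite_poly p q z = INR p *
     (z * hermite_poly (pred p) q z
      - INR q * hermite_poly (pred p) (pred q) z))
    by (destruct p; [simpl; ring | now rewrite IH]).
  rewrite !S_INR, !RtoC_plus.
  transitivity (z * Cconj z * hermite_poly p q z
    - (INR q * (Cconj z * hermite_poly p (pred q) z)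
       + INR p * hermite_poly p q z) - hermite_poly p q z); [ring |].
  rewrite E'.
  transitivity (z * Cconj z * hermite_poly p q z
    - (INR p * (z * hermite_poly (pred p) q z)
       + INR q * hermite_poly p q z) - hermite_poly p q z);
    [rewrite E |]; ring.
Qed.

(** Differentiation lowers an index, as for monomials. The proof differentiates the recursion in
    [q]; its first value turns that recursion into the statement that [creation] raises [q]. *)
Lemma is_wirtinger_hermite_poly (p q : nat) (z : C) :
  is_wirtinger (hermite_poly p q) z
    (INR p * hermite_poly (pred p) q z) (INR q * hermite_poly p (pred q) z).
Proof.
  revert p; induction q as [|q IH]; intros p.
  - eapply is_wirtinger_eq;
      [apply (is_wirtinger_pow (fun w => w)), is_wirtinger_id | |];
      simpl; ring.
  - eapply is_wirtinger_eq.
    + apply (is_wirtinger_ext (fun _ => True) (fun w =>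
        Cconj w * hermite_poly p q w
        + - INR p * hermite_poly (pred p) q w));
        [apply open_true | exact I | intros; simpl; ring |].
      apply is_wirtinger_plus.
      * exact (is_wirtinger_mult _ _ _ _ _ _ _ (is_wirtinger_conj z) (IH p)).
      * exact (is_wirtinger_mult _ _ _ _ _ _ _
                 (is_wirtinger_const (- INR p) z) (IH (pred p))).
    + simpl; ring.
    (* The terms carrying the factor [q] recombine by the recursion at [pred q], which exists only
       for positive [q]. *)
    + destruct q as [|q].
      * simpl; ring.
      * rewrite (S_INR (S q)), RtoC_plus; cbv beta; simpl pred.
        change (hermite_poly p (S q) z) with
          (Cconj z * hermite_poly p q z - INR p * hermite_poly (pred p) q z).
        ring.
Qed.

(** * The Gaussian and Rodrigues' formula *)

Definition gauss (z : C) : C := Cexp (- (z * Cconj z)).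

Lemma Cexp_real (r : R) : Cexp r = exp r.
Proof.
  unfold Cexp; simpl; rewrite cos_0, sin_0.
  apply injective_projections; simpl; ring.
Qed.

Lemma Cmult_conj (z : C) : z * Cconj z = (Re z ^ 2 + Im z ^ 2)%R.
Proof. apply injective_projections; simpl; unfold Re, Im; ring. Qed.

Lemma gauss_real (z : C) : gauss z = exp (- (Re z ^ 2 + Im z ^ 2)).
Proof. unfold gauss; now rewrite Cmult_conj, <- RtoC_opp, Cexp_real. Qed.

Lemma Cexp_gauss (z : C) : Cexp (z * Cconj z) * gauss z = 1.
Proof.
  rewrite gauss_real, Cmult_conj, Cexp_real, <- RtoC_mult, <- exp_plus.
  now rewrite Rplus_opp_r, exp_0.
Qed.

Lemma is_wirtinger_gauss (z : C) :
  is_wirtinger gauss z (- Cconj z * gauss z) (- z * gauss z).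
Proof.
  (* Written as a real exponential, the Gaussian has imaginary part identically 0, so only two real
     derivatives have to be computed. *)
  apply (is_wirtinger_ext (fun _ => True)
    (fun w => RtoC (exp (- (Re w ^ 2 + Im w ^ 2)))));
    [apply open_true | exact I | intros; now rewrite gauss_real |].
  rewrite gauss_real.
  destruct z as [x y]; split; split; simpl.
  - auto_derive; [exact I | ring_simplify; ring].
  - eapply eq_rect; [apply @is_derive_const | unfold zero; simpl; ring].
  - auto_derive; [exact I | ring_simplify; ring].
  - eapply eq_rect; [apply @is_derive_const | unfold zero; simpl; ring].
Qed.

(** The Gaussian contributes [- conj z] under [dz] and [- z] under [dzbar]; with the index-lowering
    derivatives these form the two recursions with opposite sign. The constant [c] carries the
    accumulated signs. *)
Lemma is_wirtinger_hermite_gauss (c : C) (p q : nat) (z : C) :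
  is_wirtinger (fun w => c * (hermite_poly p q w * gauss w)) z
    (- c * (hermite_poly p (S q) z * gauss z))
    (- c * (hermite_poly (S p) q z * gauss z)).
Proof.
  eapply is_wirtinger_eq.
  - apply is_wirtinger_mult; [apply is_wirtinger_const |].
    apply is_wirtinger_mult;
      [apply is_wirtinger_hermite_poly | apply is_wirtinger_gauss].
  - simpl; ring.
  - rewrite hermite_poly_S_l; ring.
Qed.

Lemma iter_dz_gauss (q : nat) (z : C) :
  Nat.iter q dz gauss z = (-1) ^ q * (hermite_poly 0 q z * gauss z).
Proof.
  revert z; induction q as [|q IH]; intros z; [simpl; ring |].
  change (dz (Nat.iter q dz gauss) z
    = (-1) ^ S q * (hermite_poly 0 (S q) z * gauss z)).
  rewrite (dz_ext (fun _ => True) _ _ z open_true I (fun w _ => IH w)).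
  destruct (is_wirtinger_unique _ _ _ _
    (is_wirtinger_hermite_gauss ((-1) ^ q) 0 q z)) as [-> _].
  rewrite Cpow_S; ring.
Qed.

Lemma iter_dzbar_dz_gauss (p q : nat) (z : C) :
  Nat.iter p dzbar (Nat.iter q dz gauss) z
  = (-1) ^ (p + q) * (hermite_poly p q z * gauss z).
Proof.
  revert z; induction p as [|p IH]; intros z; [apply iter_dz_gauss |].
  change (dzbar (Nat.iter p dzbar (Nat.iter q dz gauss)) z
    = (-1) ^ (S p + q) * (hermite_poly (S p) q z * gauss z)).
  eapply is_wirtinger_unique, is_wirtinger_eq; [| reflexivity |].
  - apply (is_wirtinger_ext (fun _ => True)
      (fun w => (-1) ^ (p + q) * (hermite_poly p q w * gauss w)));
      [apply open_true | exact I | intros; now rewrite IH |].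
    apply is_wirtinger_hermite_gauss.
  - simpl Init.Nat.add; rewrite Cpow_S; ring.
Qed.

(** The two signs [(-1)^(p+q)] multiply to 1 and the prefactor [exp(|z|^2)] cancels the Gaussian. *)
Lemma Hermite_hermite_poly (p q : nat) (z : C) :
  Hermite p q z = hermite_poly p q z.
Proof.
  unfold Hermite; fold gauss; rewrite iter_dzbar_dz_gauss.
  transitivity ((-1 * -1) ^ (p + q) * (Cexp (z * Cconj z) * gauss z)
                * hermite_poly p q z).
  - rewrite Cpow_mult_l; ring.
  - rewrite Cexp_gauss.
    replace (-1 * -1) with (RtoC 1) by ring.
    rewrite Cpow_1_l; ring.
Qed.

(** * The punctured plane and the two expansions *)

Lemma open_neq_0_C : open (fun z : C => z <> 0).
Proof.
  apply (open_ext (fun z : C => Re z <> 0 \/ Im z <> 0)).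
  - intros z; split.
    + intros [H | H] E; apply H; now rewrite E.
    + intros H; destruct (Req_dec (Re z) 0) as [Hr | Hr]; [right | now left].
      intros Hi; apply H; now apply injective_projections.
  - apply open_or.
    + apply (open_comp fst (fun r : R => r <> 0%R)); [| apply open_neq].
      intros [x y] _; apply continuous_fst.
    + apply (open_comp snd (fun r : R => r <> 0%R)); [| apply open_neq].
      intros [x y] _; apply continuous_snd.
Qed.

Lemma iter_creation_hermite_poly (p n : nat) (Omega : C -> Prop) (g : C -> C) :
  open Omega -> class_C n Omega g ->
  forall z, Omega z ->
  Nat.iter n creation (fun w => w ^ p * g w) z =
  INR (fact n) *
  sum_n (fun k =>
    (-1) ^ k / INR (fact k) *
    (hermite_poly p (n - k) z / INR (fact (n - k))) * Nat.iter k dz g z) n.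
Proof.
  intros HO Hg z Hz.
  apply (iter_creation_mult Omega (hermite_poly p)
    (fun j w => INR j * hermite_poly p (pred j) w)); try assumption.
  (* By the recursion, [conj w H_{p,j} - H_{p,j+1}] is [p H_{p-1,j}], the [dz] derivative of
     [H_{p,j}]. *)
  intros j w; eapply is_wirtinger_eq;
    [apply is_wirtinger_hermite_poly | simpl; ring | reflexivity].
Qed.

Theorem proposition2p2 (p q : nat) (hp : (0 < p)%nat) (hq : (0 < q)%nat)
  (Omega : C -> Prop) (hOmega : open Omega)
  (f : C -> C) (hf : class_C q Omega f) :
  (forall z : C, Omega z ->
    Nat.iter q creation f z =
    INR (fact q) *
    sum_n (fun k : nat =>
      (-1) ^ k / INR (fact k) *
      (Cconj z ^ (q - k) / INR (fact (q - k))) *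
      Nat.iter k dz f z) q)
  /\
  (forall z : C, Omega z -> z <> 0 ->
    Nat.iter q creation f z =
    INR (fact q) *
    sum_n (fun k : nat =>
      (-1) ^ k / INR (fact k) *
      (Hermite p (q - k) z / INR (fact (q - k))) *
      Nat.iter k dz (fun w : C => / (w ^ p) * f w) z) q).
Proof.
  split.
  - intros z Hz.
    rewrite (iter_creation_ext q Omega f (fun w => w ^ 0 * f w));
      [| assumption | intros; simpl; ring | assumption].
    rewrite (iter_creation_hermite_poly 0 q Omega) by assumption.
    f_equal; apply sum_n_ext; intros k; now rewrite hermite_poly_0_l.
  - intros z Hz Hz0.
    (* Removing the origin leaves an open set on which [z^{-p} f] keeps class C^q and
       [f = z^p (z^{-p} f)]. *)
    set (A := fun w : C => Omega w /\ w <> 0).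
    assert (HA : open A) by (apply open_and; [exact hOmega | apply open_neq_0_C]).
    rewrite (iter_creation_ext q A f (fun w => w ^ p * (/ w ^ p * f w)));
      [| assumption
       | intros w [_ Hw]; field; now apply Cpow_nz
       | now split].
    rewrite (iter_creation_hermite_poly p q A); [| assumption | | now split].
    + f_equal; apply sum_n_ext; intros k; now rewrite Hermite_hermite_poly.
    + apply (class_C_mult q A (fun w => / w ^ p)); [exact HA | |].
      (* Moving the power outside the inverse reduces regularity to that of [Cinv] and of its
         powers. *)
      * apply (class_C_ext q A (fun w => (/ w) ^ p)); [exact HA | |].
        -- intros w [_ Hw]; now apply Cpow_inv.
        -- apply class_C_pow; [exact HA |].
           apply class_C_Cinv; [exact HA | now intros w []].
      * apply (class_C_subset q A Omega); [now intros w [] | exact hf].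
Qed.
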